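(* Let $(M,d)$ be a metric space and let $\alpha \in (0,1]$. Then the Hölder space $C^\alpha(M)$ has the weak Banach--Saks property if and only if $M$ is finite.
   Context: A Banach space $X$ has the weak Banach--Saks property (is weakly Banach--Saks) if every weakly convergent sequence $x_n \to x$ in $X$ contains a subsequence $(x_{n_k})$ such that $\left\| \frac{1}{N}\sum_{k=1}^N x_{n_k} - x \right\|_X \to 0$ as $N \to \infty$. For a metric space $(M,d)$, $C_b(M)$ denotes the space of all bounded continuous functions $f: M \to \mathbb{R}$, with norm $\|f\|_{C(M)} := \sup_{x\in M}|f(x)|$. For $0<\alpha\le 1$ and $f \in C_b(M)$ put $$\rho_{\alpha,M}(f) := \sup_{x,y\in M,\ x\neq y} \frac{|f(x)-f(y)|}{d(x,y)^\alpha}.$$ The Hölder space is $C^\alpha(M) := \{ f\in C_b(M) : \rho_{\alpha,M}(f)<\infty\}$, with norm $\|f\|_{C^\alpha(M)} := \|f\|_{C(M)} + \rho_{\alpha,M}(f)$; it is a Banach space. *)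

(* Defs.v *)
From HB Require Import structures.
From mathcomp Require Import all_boot all_order all_algebra.
From mathcomp Require Import all_classical all_reals all_analysis.
From mathcomp Require Import ring lra.
Import Order.TTheory GRing.Theory Num.Theory.
Import numFieldNormedType.Exports.

Set Implicit Arguments.
Unset Strict Implicit.
Unset Printing Implicit Defensive.

Local Open Scope classical_set_scope.
Local Open Scope ring_scope.

Definition weakly_cvg {R : realType} {X : normedModType R}
    (u : nat -> X) (x : X) : Prop :=
  forall phi : {linear X -> R^o}, continuous phi -> phi (u n) @[n --> \oo] --> phi x.

(* The subsequence is indexed from 0, so the first N terms are k = 0, ..., N-1. *)
Definition weakly_banach_saks {R : realType} (X : completeNormedModType R) : Prop :=
  forall (u : nat -> X) (x : X), weakly_cvg u x ->
    exists2 s : nat -> nat, {homo s : m n / (m < n)%N} &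
      `|N%:R^-1 *: (\sum_(k < N) u (s k)) - x| @[N --> \oo] --> (0 : R).

Section HolderSpace.
Context {R : realType} (M : metricType R) (alpha : R).
Implicit Types (f g : M -> R).

Definition bounded_continuous f : Prop :=
  has_ubound (range (fun x => `|f x|)) /\ continuous f.

(* [sup set0 = 0], so this is 0 on the empty space, and the seminorm below
   is 0 on a space with at most one point. *)
Definition sup_norm f : R := sup (range (fun x => `|f x|)).

Definition holder_quotients f : set R :=
  [set `|f p.1 - f p.2| / mdist p.1 p.2 `^ alpha | p in [set p : M * M | p.1 != p.2]].

(* On a set without upper bound [sup] takes the value 0; finiteness of the
   supremum is therefore the separate condition in [holder_continuous]. *)
Definition holder_seminorm f : R := sup (holder_quotients f).

Definition holder_continuous f : Prop :=
  bounded_continuous f /\ has_ubound (holder_quotients f).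

Definition holder_pred : {pred M -> R} := mem [set f | holder_continuous f].

Record holder_space := HolderSpace {
  holder_fun :> M -> R ;
  _ : holder_fun \in holder_pred }.

HB.instance Definition _ := [isSub for holder_fun].
HB.instance Definition _ := [Choice of holder_space by <:].

Lemma holder_spaceP (f : holder_space) : holder_continuous f.
Proof. by have := valP f; rewrite inE. Qed.

Definition holder_norm f : R := sup_norm f + holder_seminorm f.

Let sup_ge0 (A : set R) : (forall r, A r -> 0 <= r) -> 0 <= sup A.
Proof.
move=> A0; have [[[r Ar] ubA]|nsA] := pselect (has_sup A); last by rewrite sup_out.
by rewrite (le_trans (A0 _ Ar))// ub_le_sup.
Qed.

Let sup_le_ge0 (A : set R) (c : R) : 0 <= c -> ubound A c -> sup A <= c.
Proof.
move=> c0 Ac; have [->|/set0P A0] := eqVneq A set0; first by rewrite sup0.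
exact: ge_sup.
Qed.

Let mdistX_gt0 (x y : M) : x != y -> 0 < mdist x y `^ alpha.
Proof. by move=> xy; rewrite powR_gt0// mdist_gt0. Qed.

Let ubound_range f (c : R) :
  ubound (range (fun x => `|f x|)) c <-> (forall x, `|f x| <= c).
Proof. by split=> [fc x|fc _ [x _ <-]//]; apply: fc; exists x. Qed.

Let ubound_quotients f (c : R) : ubound (holder_quotients f) c <->
  (forall x y, x != y -> `|f x - f y| <= c * mdist x y `^ alpha).
Proof.
split=> [fc x y xy|fc _ [[x y]/= xy <-]].
  by rewrite -ler_pdivrMr ?mdistX_gt0//; apply: fc; exists (x, y).
by rewrite ler_pdivrMr ?mdistX_gt0// fc.
Qed.

Lemma sup_norm_ge0 f : 0 <= sup_norm f.
Proof. by apply: sup_ge0 => _ [x _ <-]. Qed.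

Lemma holder_seminorm_ge0 f : 0 <= holder_seminorm f.
Proof. by apply: sup_ge0 => _ [p _ <-]; rewrite divr_ge0// powR_ge0. Qed.

Lemma sup_norm_ub f x : holder_continuous f -> `|f x| <= sup_norm f.
Proof. by move=> [[fub _] _]; apply: ub_le_sup => //; exists x. Qed.

Lemma holder_seminorm_ub f x y : holder_continuous f ->
  `|f x - f y| <= holder_seminorm f * mdist x y `^ alpha.
Proof.
move=> [_ fub]; have [->|xy] := eqVneq x y.
  by rewrite subrr normr0 mulr_ge0 ?holder_seminorm_ge0 ?powR_ge0.
by rewrite -ler_pdivrMr ?mdistX_gt0//; apply: ub_le_sup => //; exists (x, y).
Qed.

Lemma sup_norm_le f (c : R) : 0 <= c -> (forall x, `|f x| <= c) -> sup_norm f <= c.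
Proof. by move=> c0 /ubound_range; exact: sup_le_ge0. Qed.

Lemma holder_seminorm_le f (c : R) : 0 <= c ->
  (forall x y, `|f x - f y| <= c * mdist x y `^ alpha) -> holder_seminorm f <= c.
Proof.
by move=> c0 fc; apply: sup_le_ge0 => //; apply/ubound_quotients => x y _.
Qed.

Lemma holder_continuousI f (a b : R) : continuous f -> (forall x, `|f x| <= a) ->
  (forall x y, `|f x - f y| <= b * mdist x y `^ alpha) -> holder_continuous f.
Proof.
move=> cf fa fb; split; first by split=> //; exists a; apply/ubound_range.
by exists b; apply/ubound_quotients => x y _.
Qed.

Lemma holder_submod_closed : submod_closed holder_pred.
Proof.
split.
  rewrite inE; apply: (@holder_continuousI _ 0 0) => [x|x|x y].
  - exact: cvg_cst.
  - by rewrite normr0.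
  - by rewrite subrr normr0 mul0r.
move=> a f g /[!inE] hf hg.
apply: (@holder_continuousI _ (`|a| * sup_norm f + sup_norm g)
    (`|a| * holder_seminorm f + holder_seminorm g)) => [x|x|x y].
- apply: (@continuousD _ _ _ (a *: f) g); last exact: hg.1.2.
  exact: (@continuousZl_tmp _ _ _ f a x (hf.1.2 x)).
- rewrite (le_trans (ler_normD _ _))// normrM lerD ?ler_wpM2l//; exact: sup_norm_ub.
- have -> : (a *: f + g) x - (a *: f + g) y = a * (f x - f y) + (g x - g y).
    by rewrite mulrBr opprD addrACA.
  rewrite (le_trans (ler_normD _ _))// normrM mulrDl -mulrA.
  by rewrite lerD ?ler_wpM2l//; exact: holder_seminorm_ub.
Qed.

HB.instance Definition _ :=
  GRing.isSubmodClosed.Build _ _ holder_pred holder_submod_closed.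
HB.instance Definition _ := [SubChoice_isSubLmodule of holder_space by <:].

Let holder_norm_le f (a b : R) : 0 <= a -> 0 <= b -> (forall x, `|f x| <= a) ->
  (forall x y, `|f x - f y| <= b * mdist x y `^ alpha) -> holder_norm f <= a + b.
Proof.
by move=> a0 b0 fa fb; rewrite lerD ?sup_norm_le ?holder_seminorm_le.
Qed.

Let ler_holder_normD (f g : holder_space) :
  holder_norm (f + g : holder_space) <= holder_norm f + holder_norm g.
Proof.
have hf := holder_spaceP f; have hg := holder_spaceP g.
rewrite /holder_norm addrACA; apply: holder_norm_le => [||x|x y].
- by rewrite addr_ge0// sup_norm_ge0.
- by rewrite addr_ge0// holder_seminorm_ge0.
- by rewrite (le_trans (ler_normD _ _))// lerD//; exact: sup_norm_ub.
- have -> : (f + g : holder_space) x - (f + g : holder_space) y = (f x - f y) + (g x - g y).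
    by rewrite opprD addrACA.
  by rewrite (le_trans (ler_normD _ _))// mulrDl lerD//; exact: holder_seminorm_ub.
Qed.

Let holder_normZ_le (a : R) (f : holder_space) :
  holder_norm (a *: f : holder_space) <= `|a| * holder_norm f.
Proof.
have hf := holder_spaceP f.
rewrite mulrDr; apply: holder_norm_le => [||x|x y].
- by rewrite mulr_ge0// sup_norm_ge0.
- by rewrite mulr_ge0// holder_seminorm_ge0.
- by rewrite normrM ler_wpM2l//; exact: sup_norm_ub.
- have -> : (a *: f : holder_space) x - (a *: f : holder_space) y = a * (f x - f y) by rewrite mulrBr.
  by rewrite normrM -mulrA ler_wpM2l//; exact: holder_seminorm_ub.
Qed.

Let holder_norm0_eq0 (f : holder_space) : holder_norm f = 0 -> f = 0.
Proof.
move=> /eqP; rewrite paddr_eq0 ?sup_norm_ge0 ?holder_seminorm_ge0//.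
move=> /andP[/eqP f0 _]; apply/val_inj/funext => x /=.
by apply/eqP; rewrite -normr_le0 -f0; exact/sup_norm_ub/holder_spaceP.
Qed.

Let holder_normZ (a : R) (f : holder_space) :
  holder_norm (a *: f : holder_space) = `|a| * holder_norm f.
Proof.
apply/eqP; rewrite eq_le holder_normZ_le/=.
have [->|a0] := eqVneq a 0.
  by rewrite normr0 mul0r addr_ge0 ?sup_norm_ge0 ?holder_seminorm_ge0.
rewrite -ler_pdivlMl ?normr_gt0// -normfV.
by rewrite -{1}(scalerK a0 f) holder_normZ_le.
Qed.

HB.instance Definition _ := Lmodule_isNormed.Build R holder_space
  (norm := fun f : holder_space => holder_norm f) ler_holder_normD holder_normZ holder_norm0_eq0.

Lemma holder_normE (f : holder_space) : `|f| = sup_norm f + holder_seminorm f.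
Proof. by []. Qed.

Let sup_norm_le_norm (f : holder_space) x : `|f x| <= `|f|.
Proof.
rewrite holder_normE (le_trans (sup_norm_ub x (holder_spaceP f)))//.
by rewrite lerDl holder_seminorm_ge0.
Qed.

Let holder_seminorm_le_norm (f : holder_space) x y :
  `|f x - f y| <= `|f| * mdist x y `^ alpha.
Proof.
rewrite (le_trans (holder_seminorm_ub x y (holder_spaceP f)))//.
by rewrite ler_wpM2r ?powR_ge0// holder_normE lerDr sup_norm_ge0.
Qed.

Let cvg_norm_le {T : Type} (F : set_system T) (FF : ProperFilter F) (u : T -> R)
    (l c : R) :
  u t @[t --> F] --> l -> (\forall t \near F, `|u t| <= c) -> `|l| <= c.
Proof.
move=> ul uc; apply/ler_addgt0Pr => d d0.
move/cvgrPdist_le : ul => /(_ _ d0) ud.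
have [t [td tc]] := filter_ex (filterI ud uc).
by rewrite -(subrK (u t) l) addrC (le_trans (ler_normD _ _))// lerD.
Qed.

Lemma holder_space_complete (F : set_system holder_space) :
  ProperFilter F -> cauchy F -> cvg F.
Proof.
move=> FF /cauchy_ballP Fc.
have Fx (x : M) : cvg ((f : holder_space) x @[f --> F]).
  apply/cauchy_cvgP/cauchy_ballP => e e0; near_simpl.
  apply: filterS (Fc e e0) => -[f g]/=.
  rewrite -!ball_normE/= => fg.
  exact: le_lt_trans (sup_norm_le_norm (f - g : holder_space) x) fg.
pose g x : R := lim ((f : holder_space) x @[f --> F]).
have gP (e : R) : 0 < e -> \forall f \near F,
    (forall x, `|(f : holder_space) x - g x| <= e) /\
    (forall x y, `|(f x - g x) - (f y - g y)| <= e * mdist x y `^ alpha).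
  move=> e0.
  have := Fc e e0.
  move=> [[A B]/= [FA FB] AB].
  apply: filterS FA => f Af.
  have Bh : \forall h \near F, `|f - h : holder_space| <= e.
    apply: filterS FB => h Bh; have := AB (f, h) (conj Af Bh).
    by rewrite /= -ball_normE => /ltW.
  have cvg_sub (x : M) : f x - (h : holder_space) x @[h --> F] --> f x - g x.
    by apply: cvgB; [exact: cvg_cst|exact: Fx].
  split=> [x|x y].
    apply: (cvg_norm_le FF (cvg_sub x)).
    apply: filterS Bh => h; apply: le_trans.
    exact: (sup_norm_le_norm (f - h : holder_space)).
  apply: (cvg_norm_le FF (cvgB (cvg_sub x) (cvg_sub y))).
  apply: filterS Bh => h he.
  rewrite (le_trans (holder_seminorm_le_norm (f - h : holder_space) x y))//.
  by rewrite ler_wpM2r ?powR_ge0.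
have cg : continuous g.
  move=> x; apply/cvgrPdist_le => e e0.
  have e30 : 0 < e / 3 by rewrite divr_gt0.
  have [f [fg _]] := filter_ex (gP _ e30).
  have /cvgrPdist_le /(_ _ e30) := (holder_spaceP f).1.2 x.
  apply: filterS => y fxy.
  have -> : g x - g y = - (f x - g x) + (f x - f y) + (f y - g y).
    by rewrite opprB !addrA subrK addrNK.
  have -> : e = e / 3 + e / 3 + e / 3 by lra.
  do 2 (rewrite (le_trans (ler_normD _ _))// lerD//).
  by rewrite normrN.
have [f [fg1 fg2]] := filter_ex (gP 1 ltr01).
have hf := holder_spaceP f.
have hg : g \in holder_pred.
  rewrite inE; apply: (@holder_continuousI _ (sup_norm f + 1) (holder_seminorm f + 1)).
  - exact: cg.
  - move=> x; have -> : g x = f x - (f x - g x) by rewrite opprB addrC subrK.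
    by rewrite (le_trans (ler_normB _ _))// lerD//; exact: sup_norm_ub.
  - move=> x y.
    have -> : g x - g y = (f x - f y) - ((f x - g x) - (f y - g y)) by ring.
    rewrite (le_trans (ler_normB _ _))// mulrDl lerD//; exact: holder_seminorm_ub.
apply/cvg_ex; exists (HolderSpace hg).
apply/cvgrPdist_le => e e0.
have e20 : 0 < e / 2 by rewrite divr_gt0.
apply: filterS (gP _ e20) => h [h1 h2].
have e2 : 0 <= e / 2 by exact: ltW.
rewrite distrC holder_normE (splitr e); exact: holder_norm_le.
Qed.

HB.instance Definition _ := Uniform_isComplete.Build holder_space holder_space_complete.

End HolderSpace.

(* Main.v *)
(* Finite M: weak convergence implies pointwise, hence norm convergence, and the
   Cesaro means follow.
   Infinite M: the space contains a copy of l^infty, spanned by disjoint bumps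
   max(0, r_n - d(x, p_n)^alpha). The centers p_n are delta-separated if some
   free ultrafilter on M is not Cauchy; otherwise they approach its limit in the
   completion geometrically and r_n is a quarter of the distance to that limit.
   Inside l^infty, with coordinates indexed by the finite sets F such that
   #|F| <= min F, Schreier's sequence u_k = (1 if k in F, else 0)_F is weakly
   null, but the first 2m terms of any subsequence have a mean of norm at least
   1/2, as seen on the coordinate F formed by the last m of them. *)

Require Import Defs.
From HB Require Import structures.
From mathcomp Require Import all_boot all_order all_algebra.
From mathcomp Require Import all_classical all_reals all_analysis.
From mathcomp Require Import ring lra.
Import Order.TTheory GRing.Theory Num.Theory.
Import numFieldNormedType.Exports.
Local Open Scope classical_set_scope.
Local Open Scope ring_scope.

(** Each share [c / (a + b)], for [c] equal to [a] or [b], lies in [0, 1], where t <= t^alpha, and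
    the two shares add up to 1. This gives the triangle inequality for d^alpha. *)
Lemma subadditive_powR (R : realType) (alpha a b : R) :
  0 < alpha -> alpha <= 1 -> 0 <= a -> 0 <= b ->
  (a + b) `^ alpha <= a `^ alpha + b `^ alpha.
Proof.
move=> alpha_gt0 alpha_le1 a0 b0.
have [s0|s_neq0] := eqVneq (a + b) 0.
  by rewrite s0 powR0 ?gt_eqF// addr_ge0 ?powR_ge0.
have s_gt0 : 0 < a + b by rewrite lt0r s_neq0 addr_ge0.
have part (c : R) : 0 <= c -> c <= a + b -> c / (a + b) * (a + b) `^ alpha <= c `^ alpha.
  move=> c0 cs; have -> : c `^ alpha = (c / (a + b) * (a + b)) `^ alpha by rewrite divfK.
  rewrite powRM ?divr_ge0 ?(ltW s_gt0)//.
  rewrite ler_wpM2r ?powR_ge0//.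
  have [->|c_neq0] := eqVneq c 0; first by rewrite mul0r powR_ge0.
  by rewrite ger1_powR// ler_pdivrMr// mul1r cs divr_gt0// lt0r c_neq0.
have <- : a / (a + b) * (a + b) `^ alpha + b / (a + b) * (a + b) `^ alpha
    = (a + b) `^ alpha by rewrite -mulrDl -mulrDl divff// mul1r.
by rewrite lerD// part// ?lerDl ?lerDr.
Qed.

(** * Choice of the centers and radii of the bumps *)

Section BumpCenters.
Variables (R : realType) (M : Type) (rho : M -> M -> R).
Hypothesis rho_sym : forall x y, rho x y = rho y x.
Hypothesis rho_triangle : forall x y z, rho x z <= rho x y + rho y z.
Hypothesis rho_eq0 : forall x y, rho x y <= 0 -> x = y.
Hypothesis M_infinite : infinite_set [set: M].

(** The cofinite filter is proper because [M] is infinite. Maximality will decide, for each ball,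
    whether it or its complement is large. *)
Lemma free_ultrafilter :
  exists2 U : set_system M, UltraFilter U & forall x, U (~` [set x]).
Proof.
have FF : ProperFilter [set A : set M | finite_set (~` A)].
  apply: Build_ProperFilter_ex => [A /= finA|].
    apply/set0P/eqP => A0; apply: M_infinite.
    by move: finA; rewrite A0 setC0.
  split=> [|A B /= finA finB|A B AB /=]; first by rewrite /= setCT.
    by rewrite setCI finite_setU.
  by apply: sub_finite_set; exact: subsetC.
have [U [U_ultra FU]] := ultraFilterLemma FF.
by exists U => // x; apply: FU; rewrite /= setCK.
Qed.

Lemma separated_sequence (U : set_system M) (delta : R) : ProperFilter U ->
  (forall x, U [set y | delta <= rho x y]) ->
  exists p : nat -> M, forall m n, (m < n)%N -> delta <= rho (p m) (p n).
Proof.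
move=> UU Usep.
(* A state holds the last chosen point and the member of [U] from which the next one is taken. The
   guard [U s.2] makes the relation total, as dependent choice requires. The point of the initial
   state is a dummy, so the sequence starts with [f 1]. *)
pose step (s t : M * set M) := U s.2 ->
  [/\ s.2 t.1, t.2 = s.2 `&` [set y | delta <= rho t.1 y] & U t.2].
have stepP s : {t | step s t}.
  have [Us|nUs] := pselect (U s.2); last by exists s.
  have [x sx] := cid (filter_ex Us).
  by exists (x, s.2 `&` [set y | delta <= rho x y]) => _; split=> //; exact: filterI.
have [x0 _] := infinite_setN0 M_infinite.
have [f [f0 fS]] := dependent_choice stepP (x0, setT).
have Uf n : U (f n).2.
  by elim: n => [|n IHn]; [rewrite f0; exact: filterT|have [] := fS n IHn].
exists (fun n => (f n.+1).1) => m n mn.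
have [_ fm _] := fS _ (Uf m).
have [fn _ _] := fS _ (Uf n).
have sub : (f n).2 `<=` (f m.+1).2.
  rewrite -(subnK mn); elim: (n - m.+1)%N => [//|k IHk].
  by have [_ -> _] := fS _ (Uf (k + m.+1)%N); exact: subset_trans IHk.
by have := sub _ fn; rewrite fm => -[].
Qed.

Section Cauchy.
Variable U : set_system M.
Hypothesis U_ultra : UltraFilter U.
Hypothesis U_free : forall x, U (~` [set x]).
Hypothesis U_cauchy : forall e : R, 0 < e -> exists x, U [set y | rho x y < e].

(* The distance to the point of the completion to which [U] converges. *)
Let D x : R := lim (rho x y @[y --> U]).

Let rho_dist x y z : `|rho x y - rho x z| <= rho y z.
Proof.
have := rho_triangle x y z; have := rho_triangle x z y.
by rewrite (rho_sym z y) ler_norml; lra.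
Qed.

Let U_filter : ProperFilter U.
Proof. exact: ultra_proper. Qed.

(** [rho x] is 1-Lipschitz, so it maps the Cauchy filter [U] to a Cauchy filter of reals. *)
Let D_cvg x : rho x y @[y --> U] --> D x.
Proof.
apply/cauchy_cvgP/cauchy_exP => e e0; have [z Uz] := U_cauchy e e0.
exists (rho x z); change (U [set y | ball (rho x z) e (rho x y)]).
apply: filterS Uz => y /= zy.
by rewrite -ball_normE/=; exact: le_lt_trans (rho_dist x z y) zy.
Qed.

Let D_le x y : D x <= rho x y + D y.
Proof.
rewrite -lerBlDr; apply: (cvgr_to_le (cvgB (D_cvg x) (D_cvg y))).
apply: (@nearW _ U) => z /=.
by have := rho_triangle x y z; rewrite -lerBlDr.
Qed.

Let rho_le x y : rho x y <= D x + D y.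
Proof.
apply: (cvgr_to_ge (cvgD (D_cvg x) (D_cvg y))).
by apply: (@nearW _ U) => z; have := rho_triangle x z y; rewrite (rho_sym z y).
Qed.

Let D_small (e : R) : 0 < e -> U [set x | D x <= e].
Proof.
move=> e0; have e20 : 0 < e / 2 by rewrite divr_gt0.
have [z Uz] := U_cauchy (e / 2) e20.
have Dz : D z <= e / 2.
  by apply: (cvgr_to_le (D_cvg z)); apply: filterS Uz => y /= /ltW.
apply: filterS Uz => y /= zy.
by have := D_le y z; rewrite (rho_sym y z); lra.
Qed.

(** By [rho_le], two points with D <= 0 coincide; so at most one point is excluded, and [U] is
    free. *)
Let D_gt0 : U [set x | 0 < D x].
Proof.
have [[z Dz]|nD] := pselect (exists z, D z <= 0).
  apply: filterS (U_free z) => x /= xz; rewrite ltNge; apply/negP => Dx.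
  by apply: xz; apply: rho_eq0; have := rho_le x z; lra.
by apply: filterE => x; rewrite /= ltNge; apply/negP => Dx; apply: nD; exists x.
Qed.

Lemma geometric_approach : exists (p : nat -> M) (r : nat -> R),
  [/\ forall n, 0 < r n,
      forall n, r n.+1 <= r n / 4,
      forall m n, r m * 4 - r n * 4 <= rho (p m) (p n) &
      forall m n, rho (p m) (p n) <= r m * 4 + r n * 4].
Proof.
pose step x y := 0 < D x -> 0 < D y <= D x / 4.
have stepP x : {y | step x y}.
  have [Dx|nDx] := pselect (0 < D x); last by exists x.
  have Dx4 : 0 < D x / 4 by rewrite divr_gt0.
  have [y [y0 yx]] := cid (filter_ex (filterI D_gt0 (D_small _ Dx4))).
  by exists y => _; apply/andP.
have [x0 Dx0] := filter_ex D_gt0.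
have [p [p0 pS]] := dependent_choice stepP x0.
have Dp n : 0 < D (p n).
  by elim: n => [|n IHn]; [rewrite p0|have /andP[] := pS n IHn].
(* With D = 4 r, distinct centers are at least 4 r m - 4 r n apart, which exceeds r m + r n as soon
   as r n <= r m / 4; this will make the balls disjoint. *)
exists p, (fun n => D (p n) / 4); split=> [n|n|m n|m n].
- by rewrite divr_gt0.
- by have /andP[_] := pS n (Dp n); lra.
- by have := D_le (p m) (p n); lra.
- by have := rho_le (p m) (p n); lra.
Qed.

End Cauchy.

(* If [r] is bounded below, the sup norm of [f] suffices for the third property;
   otherwise [p] is Cauchy and [f (p n)] is compared with the values of [f] far
   out in the sequence, which tend to 0. *)
Lemma bump_centers : exists (p : nat -> M) (r : nat -> R) (C : R),
  [/\ forall n, 0 < r n <= C,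
      forall m n, m != n -> r m + r n <= rho (p m) (p n) &
      forall (f : M -> R) (K S : R), (forall x, `|f x| <= S) ->
        (forall x y, `|f x - f y| <= S * rho x y) ->
        (forall n, `|f (p n)| <= K * r n) -> forall n, `|f (p n)| <= C * S * r n].
Proof.
have [U UU Ufree] := free_ultrafilter.
have [Ucauchy|] := pselect (forall e : R, 0 < e -> exists x, U [set y | rho x y < e]).
  have [p [r [r0 rS rsub radd]]] := geometric_approach U UU Ufree Ucauchy.
  have rdecr k n : r (k + n.+1)%N <= r n / 4.
    elim: k => [|k IHk]; first exact: rS.
    by rewrite addSn; have := rS (k + n.+1)%N; have := r0 (k + n.+1)%N; lra.
  have rlt m n : (m < n)%N -> r n <= r m / 4 by move/subnK <-; exact: rdecr.
  have rgeo n : r n <= r 0%N * 4^-1 ^+ n.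
    elim: n => [|n IHn]; first by rewrite expr0 mulr1.
    by rewrite exprSr mulrA; have := rS n; lra.
  have r_to0 : r n @[n --> \oo] --> (0 : R).
    apply: (@squeeze_cvgr _ _ _ _ (fun=> 0) (fun n => r 0%N * 4^-1 ^+ n)).
    - by apply: filterE => n; rewrite ltW ?r0//=.
    - exact: cvg_cst.
    - by apply: cvg_geometric; rewrite ger0_norm//; lra.
  (* [r 0] bounds all radii; 8 covers rho (p n) (p m) <= 4 (r n + r m) with r m <= r n for m > n. *)
  exists p, r, (r 0%N + 8); split=> [n|m n|f K S fS fL fK n].
  - rewrite r0/=; case: n => [|n]; first lra.
    by have := rlt 0%N n.+1 isT; have := r0 0%N; lra.
  - wlog mn : m n / (m < n)%N => [H|_].
      by rewrite neq_lt => /orP[mn|nm]; [|rewrite addrC rho_sym]; apply: H; rewrite // neq_lt ?mn ?nm.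
    by have := rsub m n; have := rlt m n mn; have := r0 n; lra.
  - have S0 : 0 <= S by exact: le_trans (fS (p n)).
    have Krn : K * r m @[m --> \oo] --> (0 : R).
      by rewrite -[X in _ --> X](mulr0 K); apply: cvgM => //; exact: cvg_cst.
    suff : `|f (p n)| <= 8 * S * r n.
      by move/le_trans; apply; rewrite ler_wpM2r ?ler_wpM2r ?(ltW (r0 _))//; have := r0 0%N; lra.
    apply/ler_addgt0Pr => e e0.
    move/cvgrPdist_le : Krn => /(_ _ e0) Krn.
    have [m [/= me nm]] := filter_ex (filterI Krn (nbhs_infty_gt n)).
    have rm := rlt _ _ nm; have := r0 m => rm0.
    rewrite -(subrK (f (p m)) (f (p n))) (le_trans (ler_normD _ _))// lerD//.
      rewrite (le_trans (fL _ _))// (mulrC 8) -mulrA ler_wpM2l//.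
      by have := radd n m; have := r0 n; lra.
    apply: le_trans (fK m) _; move: me; rewrite sub0r normrN.
    exact/le_trans/ler_norm.
(* No ball of some radius [delta] belongs to [U], so by maximality the complement of each does. *)
move=> /existsNP[delta /not_implyP[delta0 /forallNP nball]].
have [x|p psep] := separated_sequence U delta _.
  have [] := in_ultra_setVsetC [set y | rho x y < delta] UU; first by move/nball.
  by apply: filterS => y /= /negP; rewrite -leNgt.
(* [delta / 2] bounds the radii, and [2 / delta] times the radius is 1, which recovers the bound
   [S]. *)
exists p, (fun=> delta / 2), (delta / 2 + 2 / delta); split=> [n|m n|f K S fS fL fK n].
- by rewrite divr_gt0//= lerDl divr_ge0// ltW.
- rewrite -splitr neq_lt => /orP[] /psep//.
  by rewrite rho_sym.
- have S0 : 0 <= S by exact: le_trans (fS (p n)).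
  rewrite (le_trans (fS _))// (_ : _ * _ = (delta / 2) ^+ 2 * S + S).
    by rewrite lerDr mulr_ge0// sqr_ge0.
  by field; rewrite gt_eqF.
Qed.

End BumpCenters.

(** * A copy of l^infty in the Hölder space *)

Section HolderEmbedding.
Variables (R : realType) (M : metricType R) (alpha : R).
Hypotheses (alpha_gt0 : 0 < alpha) (alpha_le1 : alpha <= 1).

Lemma continuous_holder_bound (f : M -> R) (L : R) :
  (forall x y, `|f x - f y| <= L * mdist x y `^ alpha) -> continuous f.
Proof.
move=> fL x; apply/cvgrPdist_le => e e0.
have L1 : 0 < `|L| + 1 by rewrite ltr_wpDl.
pose d := (e / (`|L| + 1)) `^ alpha^-1.
have d0 : 0 < d by rewrite powR_gt0// divr_gt0.
have : nbhs x (ball x d) by exact: nbhsx_ballx.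
apply: filterS => y; rewrite ballEmdist/= => xyd.
rewrite (le_trans (fL x y))// (le_trans (ler_wpM2r (powR_ge0 _ _) (ler_norm L)))//.
have xyX : mdist x y `^ alpha <= e / (`|L| + 1).
  have -> : e / (`|L| + 1) = d `^ alpha.
    by rewrite /d -powRrM mulVf ?gt_eqF// powRr1// divr_ge0// ltW.
  by rewrite ge0_ler_powR ?nnegrE ?mdist_ge0 ?ltW.
rewrite (le_trans (ler_wpM2l (normr_ge0 L) xyX))//.
by rewrite mulrCA ger_pMr// ler_pdivrMr// mul1r lerDl.
Qed.

(** The combination of the bumps with coefficients [a] is written pointwise, without an infinite
    sum: [i x] is the index of the only bump that can be nonzero at [x], and [b x] is its value
    there. The two norm bounds make the map from [a] to [f] an isomorphism of l^infty onto its
    image. *)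
Lemma linf_embedding : infinite_set [set: M] ->
  exists (i : M -> nat) (b : M -> R) (C : R), 0 < C /\
    forall (f : M -> R) (a : nat -> R) (K : R),
      (forall x, f x = a (i x) * b x) -> (forall n, `|a n| <= K) ->
      [/\ holder_continuous alpha f, holder_norm alpha f <= C * K &
          forall n, `|a n| <= C * holder_norm alpha f].
Proof.
move=> M_infinite.
pose rho x y : R := @mdist R M x y `^ alpha.
have rho_ge0 x y : 0 <= rho x y by exact: powR_ge0.
have rhoxx x : rho x x = 0 by rewrite /rho mdistxx powR0 ?gt_eqF.
have rho_sym x y : rho x y = rho y x by rewrite /rho metric_sym.
have rho_triangle x y z : rho x z <= rho x y + rho y z.
  rewrite (le_trans _ (subadditive_powR _ _ _ _ alpha_gt0 alpha_le1 (mdist_ge0 x y) (mdist_ge0 y z)))//.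
  by rewrite ge0_ler_powR ?nnegrE ?mdist_ge0 ?addr_ge0 ?mdist_ge0 ?metric_triangle ?ltW.
have rho_eq0 x y : rho x y <= 0 -> x = y.
  move=> xy0; have /eqP : rho x y = 0 by apply/eqP; rewrite eq_le xy0 rho_ge0.
  by rewrite /rho powR_eq0 => /andP[/eqP /mdist_positivity].
have [p [r [C [r_bnd r_sep r_norm]]]] :=
  bump_centers _ _ _ rho_sym rho_triangle rho_eq0 M_infinite.
have r0 n : 0 < r n by have /andP[] := r_bnd n.
have C0 : 0 < C by have /andP[rn] := r_bnd 0%N; exact: lt_le_trans.
pose inball x n := rho x (p n) < r n.
(* The default 0 outside all balls is harmless, since [bump 0] vanishes there. *)
pose i x : nat := xget 0%N [set n | inball x n].
have i_inball x n : inball x n -> i x = n.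
  move=> xn; rewrite /i; case: xgetP => [m _ xm|/(_ n)//].
  apply/eqP/negP => /negP /r_sep; apply/negP; rewrite -ltNge.
  rewrite (le_lt_trans (rho_triangle _ x _))// ltrD//.
  by rewrite rho_sym.
pose bump n x := Num.max 0 (r n - rho x (p n)).
have bump_ge0 n x : 0 <= bump n x by rewrite le_max lexx.
have bump_le n x : bump n x <= r n by rewrite ge_max ltW ?r0//= gerBl.
have bump_lip n x y : bump n x - bump n y <= rho x y.
  rewrite lerBlDr ge_max addr_ge0//=.
  apply: (@le_trans _ _ (rho x y + (r n - rho y (p n)))); last by rewrite lerD2l le_max lexx orbT.
  by have := rho_triangle y x (p n); rewrite (rho_sym y x); lra.
have bump_gt0 n x : 0 < bump n x -> inball x n.
  by rewrite /bump lt_max ltxx/= subr_gt0.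
pose b x := bump (i x) x.
have b_disjoint x y : i x != i y -> b x <= rho x y.
  move=> ixy; have bumpy : bump (i x) y = 0.
    apply/eqP; rewrite eq_le bump_ge0 andbT leNgt; apply/negP => /bump_gt0/i_inball iy.
    by rewrite iy eqxx in ixy.
  by have := bump_lip (i x) x y; rewrite bumpy subr0.
have rhopp n : inball (p n) n by rewrite /inball rhoxx.
have ip n : i (p n) = n by apply: i_inball; exact: rhopp.
have bp n : b (p n) = r n by rewrite /b ip /bump rhoxx subr0 max_r// ltW.
exists i, b, (C + 2); split; first by rewrite addr_gt0.
move=> f a K fE aK.
have K0 : 0 <= K by exact: le_trans (aK 0%N).
have f_le x : `|f x| <= C * K.
  rewrite fE normrM mulrC ler_pM ?aK// ger0_norm ?bump_ge0//.
  by rewrite (le_trans (bump_le _ _))//; have /andP[] := r_bnd (i x).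
have ab_le x c : b x <= c -> `|f x| <= K * c.
  by move=> bc; rewrite fE normrM ler_pM ?aK// ger0_norm ?bump_ge0.
(* For different indices, [b_disjoint] bounds both values by K rho x y, whence the factor 2. *)
have f_lip x y : `|f x - f y| <= 2 * K * rho x y.
  have [ixy|ixy] := eqVneq (i x) (i y).
    rewrite !fE ixy -mulrBr normrM (@le_trans _ _ (K * rho x y))//.
      rewrite ler_pM ?aK// ler_norml lerNl opprB /b ixy bump_lip andbT.
      by rewrite (rho_sym x y) bump_lip.
    by rewrite ler_wpM2r// ler_peMl// lerDl.
  rewrite (le_trans (ler_normB _ _))// -mulrA mulrDl mul1r lerD ?ab_le ?b_disjoint//.
  by rewrite (rho_sym x y) b_disjoint// eq_sym.
have hf : holder_continuous alpha f.
  exact: holder_continuousI (continuous_holder_bound _ _ f_lip) f_le f_lip.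
have f_sup : sup_norm f <= C * K.
  by apply: sup_norm_le => //; rewrite mulr_ge0// ltW.
have f_semi : holder_seminorm alpha f <= 2 * K by apply: holder_seminorm_le => //; rewrite mulr_ge0.
have norm_ge0 : 0 <= holder_norm alpha f.
  by rewrite addr_ge0 ?sup_norm_ge0 ?holder_seminorm_ge0.
split=> // [|n]; first by rewrite mulrDl lerD.
(* Here |f (p n)| = |a n| r n, so dividing by [r n] bounds the coefficient. The bound [K] on [a]
   enters only as the qualitative hypothesis of [r_norm] and leaves no trace in the constant. *)
have : `|f (p n)| <= C * holder_norm alpha f * r n.
  apply: (r_norm _ K) => [x|x y|m].
  - by rewrite (le_trans (sup_norm_ub x hf))// lerDl holder_seminorm_ge0.
  - rewrite (le_trans (holder_seminorm_ub x y hf))// ler_wpM2r ?powR_ge0//.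
    by rewrite lerDr sup_norm_ge0.
  - by rewrite ab_le// bp.
rewrite fE ip bp normrM (ger0_norm (ltW (r0 n))) ler_pM2r// => /le_trans; apply.
by rewrite ler_wpM2r// lerDl.
Qed.

End HolderEmbedding.

(** * Schreier sets and a criterion for weak nullity *)

Definition schreier (F : seq nat) : bool := all (fun k => size F <= k)%N F.

(** Numbering the Schreier sets turns them into coordinates of l^infty. Codes of anything else give
    the empty set, hence a coordinate on which all [u_k] vanish. *)
Definition schreier_enum (m : nat) : seq nat :=
  if unpickle m is Some F then if schreier F then F else [::] else [::].

Lemma schreier_enumP m : schreier (schreier_enum m).
Proof. by rewrite /schreier_enum; case: unpickle => [F|]//; case: ifP. Qed.

Lemma schreier_enumK F : schreier F -> schreier_enum (pickle F) = F.
Proof. by rewrite /schreier_enum pickleK => ->. Qed.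

(* Successive blocks of [L] equal weights [L^-1]: a Schreier set that meets an
   earlier block has too few elements to catch more than [1 / P] of the new
   one, if [L] is large enough. *)
Lemma schreier_weights (R : realType) (g : nat -> nat) (P q : nat) :
  {homo g : m n / (m < n)%N} -> (0 < P)%N ->
  exists (n : nat) (mu : nat -> R),
    [/\ forall j, 0 <= mu j, \sum_(0 <= j < n) mu j = q%:R &
        forall F, schreier F ->
          \sum_(0 <= j < n | g j \in F) mu j <= 1 + q%:R / P%:R].
Proof.
move=> g_incr P_gt0.
have g_mono : {mono g : m n / (m <= n)%N} by exact: leq_mono.
have P0 : 0 < P%:R :> R by rewrite ltr0n.
elim: q => [|q [n [mu [mu0 mu_sum mu_le]]]].
  exists 0%N, (fun=> 0); split=> // [|F _]; first by rewrite big_geq.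
  by rewrite big_geq// mul0r addr0.
(* A Schreier set containing some g j with j < n has at most g j <= g n elements, so it catches at
   most (g n + 1) / L = 1 / P of the new block. *)
pose L := ((g n).+1 * P)%N.
have L0 : 0 < L%:R :> R by rewrite ltr0n muln_gt0.
pose nu j : R := if (j < n)%N then mu j else L%:R^-1.
have nu_left (Q : pred nat) :
    \sum_(0 <= j < n | Q j) nu j = \sum_(0 <= j < n | Q j) mu j.
  rewrite big_nat_cond [RHS]big_nat_cond; apply: eq_bigr => j.
  by rewrite /nu => /andP[/andP[_ ->]].
have nu_right (Q : pred nat) : \sum_(n <= j < n + L | Q j) nu j
    = (count Q (index_iota n (n + L)))%:R / L%:R.
  rewrite big_nat_cond (eq_bigr (fun=> L%:R^-1)); last first.
    by move=> j /andP[/andP[nj _] _]; rewrite /nu ltnNge nj.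
  by rewrite -big_nat_cond big_const_seq iter_addr_0 mulr_natl.
exists (n + L)%N, nu; split=> [j||F schF].
- by rewrite /nu; case: ifP => // _; rewrite invr_ge0 ler0n.
- rewrite (big_cat_nat _ (leq_addr L n))//= nu_left mu_sum nu_right count_predT.
  by rewrite size_iota addKn divff ?gt_eqF// -natr1.
rewrite (big_cat_nat _ (leq_addr L n))//= nu_left nu_right.
set c := count _ _.
have c_size : (c <= size F)%N.
  rewrite /c -size_filter -(size_map g); apply: uniq_leq_size.
    rewrite map_inj_uniq ?filter_uniq ?iota_uniq//.
    by move=> x y gxy; apply/eqP; rewrite eqn_leq -(g_mono x y) -(g_mono y x) gxy leqnn.
  by move=> x /mapP[j]; rewrite mem_filter => /andP[gj _] ->.
have c_L : (c <= L)%N.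
  by rewrite /c (leq_trans (count_size _ _))// size_iota addKn.
have qP : 0 <= q%:R / P%:R :> R by rewrite divr_ge0.
have [/hasP[j]|/hasPn noF] := boolP (has (fun j => g j \in F) (index_iota 0 n)).
  rewrite mem_index_iota => /andP[_ jn] gjF.
  have cg : (c <= (g n).+1)%N.
    rewrite (leq_trans c_size)// (leq_trans (allP schF _ gjF))//.
    by rewrite ltnW// ltnS g_mono ltnW.
  rewrite -natr1 mulrDl addrA lerD ?mu_le// ler_pdivrMr// /L natrM.
  by rewrite mul1r mulrCA mulVf ?gt_eqF// mulr1 ler_nat.
(* A set that misses the earlier blocks catches only weight from the new one, at most L / L = 1. *)
rewrite big_nat_cond big_pred0 => [|j]; last first.
  by apply/andP => -[jn] ; apply/negP/noF; rewrite mem_index_iota.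
rewrite add0r (@le_trans _ _ 1)//; last by rewrite lerDl divr_ge0.
by rewrite ler_pdivrMr// mul1r ler_nat.
Qed.

(** The hypothesis dominates [u] by Schreier's sequence. If |phi (u k)| >= e for infinitely many k,
    the weights above, with the signs of phi (u k), give a combination of norm at most 2 K on which
    phi is at least P e; this is impossible for large P. *)
Lemma schreier_weakly_null (R : realType) (X : normedModType R) (u : nat -> X) (K : R) :
  (forall (g : nat -> nat) (lam : nat -> R) (n : nat) (c : R),
    (forall F, schreier F -> `|\sum_(0 <= j < n | g j \in F) lam j| <= c) ->
    `|\sum_(0 <= j < n) lam j *: u (g j)| <= K * c) ->
  weakly_cvg u 0.
Proof.
move=> u_le phi phi_cont; rewrite linear0.
have [B B0 phiB] : exists2 B : R, 0 <= B & forall x, `|phi x| <= B * `|x|.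
  have /linear_boundedP [B [_ phiB]] : bounded_near phi (nbhs 0).
    by apply: continuous_linear_bounded; exact: phi_cont.
  exists (`|B| + 1); first by rewrite addr_ge0.
  by apply: phiB; rewrite ltr_pwDr ?ler_norm.
apply/cvgrPdist_lt => e e0.
apply: contrapT => not_near.
pose A := [set k | e <= `|phi (u k)|].
have A_infinite : infinite_set A.
  move=> /finite_seqP[s As]; apply: not_near.
  apply: filterS (nbhs_infty_gt (\max_(k <- s) k)) => k /= s_lt_k.
  rewrite sub0r normrN ltNge; apply/negP => ek.
  have /= ks : [set` s] k by rewrite -As.
  by move: s_lt_k; apply/negP; rewrite -leqNgt (leq_bigmax_seq (F := fun j => j)).
have nat_fin (m : nat) : finite_set [set k | (k <= m)%O].
  by apply: sub_finite_set (finite_II m.+1) => k /=; rewrite ltnS.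
have [g [g_incr _ gA]] := infinite_increasing_seq_wf nat_fin A_infinite 0%N.
have g_homo : {homo g : m n / (m < n)%N}.
  by move=> m n; rewrite (leqW_mono g_incr).
(* [P] is chosen so that P e > 2 B K. Taking q = P blocks gives total weight P, while each Schreier
   set catches at most 1 + P / P = 2. *)
pose P := (Num.truncn (B * (K * 2) / e)).+1.
have [n [mu [mu0 mu_sum mu_le]]] := schreier_weights R g P P g_homo isT.
pose lam j := Num.sg (phi (u (g j))) * mu j.
have lam_le F : schreier F -> `|\sum_(0 <= j < n | g j \in F) lam j| <= 2.
  move=> /mu_le; rewrite divff ?pnatr_eq0// => F2.
  rewrite (le_trans (ler_norm_sum _ _ _))// (le_trans _ F2)// ler_sum// => j _.
  by rewrite normrM (ger0_norm (mu0 j)) ler_piMl// normr_sg; case: (_ != 0).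
have := le_trans (phiB (\sum_(0 <= j < n) lam j *: u (g j)))
  (ler_wpM2l B0 (u_le g lam n 2 lam_le)).
apply/negP; rewrite -ltNge linear_sum/=.
have -> : \sum_(0 <= j < n) phi (lam j *: u (g j))
    = \sum_(0 <= j < n) mu j * `|phi (u (g j))|.
  apply: eq_bigr => j _.
  by rewrite linearZ/= [`|_|]normrEsg mulrA (mulrC (mu j)).
apply: (@lt_le_trans _ _ (P%:R * e)).
  by rewrite -ltr_pdivrMr// truncnS_gt.
rewrite -mu_sum mulr_suml; apply: le_trans (ler_norm _).
by apply: ler_sum => j _; rewrite ler_wpM2l//; exact: gA.
Qed.

(** * The two implications *)

Section HolderWeakBanachSaks.
Variables (R : realType) (M : metricType R) (alpha : R).
Hypotheses (alpha_gt0 : 0 < alpha) (alpha_le1 : alpha <= 1).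
Local Notation H := (holder_space M alpha).

Definition holder_eval (y : M) (f : H) : R^o := f y.

Lemma holder_eval_linear y : linear (holder_eval y).
Proof. by []. Qed.

HB.instance Definition _ y :=
  GRing.isLinear.Build R H R^o *:%R (holder_eval y) (holder_eval_linear y).

Lemma holder_eval_continuous y : continuous (holder_eval y).
Proof.
apply/linear_bounded_continuous/linear_boundedP; near=> r => f.
apply: (@le_trans _ _ (1 * `|f|)); last first.
  by rewrite ler_wpM2r//; near: r; exact: nbhs_pinfty_ge.
rewrite mul1r holder_normE (le_trans (sup_norm_ub y (holder_spaceP f)))//.
by rewrite lerDl holder_seminorm_ge0.
Unshelve. all: by end_near. Qed.

Lemma infinite_not_weakly_banach_saks :
  infinite_set [set: M] -> ~ weakly_banach_saks H.
Proof.
move=> M_infinite HBS.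
have [i [b [C [C0 emb]]]] := linf_embedding _ _ _ alpha_gt0 alpha_le1 M_infinite.
pose a (k m : nat) : R := (k \in schreier_enum m)%:R.
have a_le1 k m : `|a k m| <= 1 by rewrite /a; case: (_ \in _); rewrite ?normr0 ?normr1.
have hu k : (fun x => a k (i x) * b x) \in @holder_pred R M alpha.
  by rewrite inE; have [] := emb _ (a k) 1 (fun=> erefl) (a_le1 k).
pose u k : H := HolderSpace (hu k).
pose coef (g : nat -> nat) (lam : nat -> R) n m : R :=
  \sum_(0 <= j < n | g j \in schreier_enum m) lam j.
have sumE (g : nat -> nat) (lam : nat -> R) n x :
    (\sum_(0 <= j < n) lam j *: u (g j)) x
    = coef g lam n (i x) * b x.
  rewrite /coef -[LHS]/(holder_eval x _) linear_sum/= mulr_suml [RHS]big_mkcond/=.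
  apply: eq_bigr => j _; rewrite -[LHS]/(lam j * (a (g j) (i x) * b x)) /a.
  by case: (_ \in _); rewrite ?mul1r// mul0r mulr0.
have u_null : weakly_cvg u 0.
  (* The coordinate F of a combination of the [u (g j)] is the sum of the [lam j] with g j in F, so
     the upper bound of the embedding is the required domination. *)
  apply: (schreier_weakly_null _ _ _ C) => g lam n c lam_le.
  have [|//] := emb _ (coef g lam n) c (sumE g lam n).
  by move=> m; apply/lam_le/schreier_enumP.
have [s s_incr] := HBS u 0 u_null.
(* By the lower bound of the embedding, a coordinate of size 1/2 forces norm at least 1 / (2 C). *)
move=> /cvgrPdist_lt /(_ (2 * C)^-1); rewrite invr_gt0 mulr_gt0// => /(_ isT) [N0 _ mean_lt].
pose m := N0.+1.
have m0 : 0 < m%:R :> R by rewrite ltr0n.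
pose N := (m + m)%N.
have N0N : 0 < N%:R :> R by rewrite ltr0n.
(* These are m indices, each at least m because k <= s k. *)
pose F := map s (index_iota m N).
have s_ge k : (k <= s k)%N.
  by elim: k => // k IHk; rewrite (leq_ltn_trans IHk)// s_incr.
have F_schreier : schreier F.
  apply/allP => _ /mapP[k + ->]; rewrite mem_index_iota size_map size_iota addnK.
  by move=> /andP[mk _]; rewrite (leq_trans mk).
pose v : H := \sum_(0 <= k < N) N%:R^-1 *: u (s k).
have v_lt : `|v| < (2 * C)^-1.
  have /mean_lt : (N0 <= N)%N by rewrite /N addSn leqW// leq_addr.
  by rewrite /= subr0 sub0r normrN normr_id scaler_sumr /v big_mkord.
have coefE k : coef s (fun=> N%:R^-1) N k
    = (count (fun j => s j \in schreier_enum k) (index_iota 0 N))%:R / N%:R.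
  by rewrite /coef big_const_seq iter_addr_0 mulr_natl.
have [k|_ _ /(_ (pickle F))] := emb v _ 1 (sumE s (fun=> N%:R^-1) N).
  rewrite coefE ger0_norm ?divr_ge0// ler_pdivrMr// mul1r ler_nat.
  by rewrite (leq_trans (count_size _ _))// size_iota subn0.
apply/negP; rewrite -ltNge coefE schreier_enumK//.
have -> : C * holder_norm alpha v = C * `|v| by [].
apply: (@lt_le_trans _ _ 2^-1).
  by rewrite -ltr_pdivlMl// -invfM (mulrC C).
rewrite ger0_norm ?divr_ge0// ler_pdivlMr//.
have mN : m%:R = 2^-1 * N%:R :> R by rewrite /N natrD; lra.
rewrite -mN ler_nat {1}/N /index_iota subn0 iotaD count_cat add0n.
have /eqP -> : count (fun j => s j \in F) (iota m m) == size (iota m m).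
  by rewrite -all_count; apply/allP => j jm; apply: map_f; rewrite /index_iota addnK.
by rewrite size_iota leq_addl.
Qed.

Lemma finite_weakly_banach_saks :
  finite_set [set: M] -> weakly_banach_saks H.
Proof.
move=> /finite_seqP[s Ms] u x u_cvg.
have inS y : y \in s by have : [set: M] y := I; rewrite Ms.
(* A crude bound for all inverse distances to the power alpha: values bounded by t then give a
   seminorm of at most 2 t C. *)
pose C : R := \sum_(y <- s) \sum_(z <- s) (mdist y z `^ alpha)^-1.
have C0 : 0 <= C.
  by apply: sumr_ge0 => y _; apply: sumr_ge0 => z _; rewrite invr_ge0 powR_ge0.
have C_ge (y z : M) : (mdist y z `^ alpha)^-1 <= C.
  rewrite /C (big_rem _ (inS y))/= (big_rem _ (inS z))/= -addrA lerDl addr_ge0//.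
    by apply: sumr_ge0 => ? _; rewrite invr_ge0 powR_ge0.
  by apply: sumr_ge0 => ? _; apply: sumr_ge0 => ? _; rewrite invr_ge0 powR_ge0.
have norm_le (f : H) t : 0 <= t -> (forall y, `|f y| <= t) -> `|f| <= t * (1 + 2 * C).
  move=> t0 ft; rewrite holder_normE mulrDr mulr1 lerD ?sup_norm_le//.
  apply: holder_seminorm_le => [|y z]; first by rewrite !mulr_ge0.
  have [->|yz] := eqVneq y z.
    by rewrite subrr normr0 mulr_ge0 ?powR_ge0// !mulr_ge0.
  have d0 : 0 < mdist y z `^ alpha by rewrite powR_gt0// mdist_gt0.
  rewrite (le_trans (ler_normB _ _))// (@le_trans _ _ (t * 2))//.
    by rewrite mulr2n mulrDr mulr1 lerD.
  rewrite -mulrA ler_wpM2l// -mulrA ler_peMr//.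
  by rewrite -ler_pdivrMr// div1r.
have pointwise e (r : seq M) : 0 < e ->
    \forall n \near \oo, forall y, y \in r -> `|u n y - x y| <= e.
  move=> e0; elim: r => [|y r IHr]; first by apply: nearW.
  have /cvgrPdist_le /(_ _ e0) := u_cvg (holder_eval y) (holder_eval_continuous y).
  apply: filterS2 IHr => n r_le y_le z; rewrite inE => /predU1P[->|]; last exact: r_le.
  by rewrite distrC.
have norm_cvg : `|u n - x| @[n --> \oo] --> (0 : R).
  apply/cvgrPdist_le => e e0.
  have C1 : 0 < 1 + 2 * C by rewrite ltr_pwDl// mulr_ge0.
  have e1 : 0 < e / (1 + 2 * C) by rewrite divr_gt0.
  apply: filterS (pointwise _ s e1) => n ux.
  rewrite sub0r normrN normr_id -(divfK (lt0r_neq0 C1) e).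
  by apply: norm_le => [|y]; [exact: ltW|exact: ux].
(* The whole sequence already works. The shift discards N = 0 and matches [arithmetic_mean], whose
   n-th term averages n + 1 values. *)
exists id => //; rewrite -cvg_shiftS.
apply: (@squeeze_cvgr _ _ _ _ (fun=> 0) (arithmetic_mean (fun n => `|u n - x|))).
- apply: nearW => n; rewrite normr_ge0/= /arithmetic_mean/= seriesEord/=.
  have -> : n.+1%:R^-1 *: (\sum_(k < n.+1) u k) - x = n.+1%:R^-1 *: \sum_(k < n.+1) (u k - x).
    rewrite sumrB scalerBr sumr_const card_ord -[x *+ _]scaler_nat scalerA.
    by rewrite mulVf ?scale1r// pnatr_eq0.
  by rewrite normrZ ger0_norm// ler_wpM2l// ler_norm_sum.
- exact: cvg_cst.
- exact: cesaro.
Qed.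

End HolderWeakBanachSaks.

Theorem theorem3p1 (R : realType) (M : metricType R) (alpha : R)
    (alpha_gt0 : 0 < alpha) (alpha_le1 : alpha <= 1) :
  weakly_banach_saks (holder_space M alpha) <-> finite_set [set: M].
Proof.
split=> [HBS|]; last exact: finite_weakly_banach_saks.
apply: contrapT => M_infinite.
exact: infinite_not_weakly_banach_saks alpha_gt0 alpha_le1 M_infinite HBS.
Qed.
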